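(* Let $n\ge3$, $C_0\in\mathbb R$, and let $u\in C^2(\mathbb R^n\setminus\overline{B_1})$ be a radially symmetric solution of $$\frac1n\sum_{i=1}^n\ln\lambda_i(D^2u)=C_0\quad\text{in }|x|>1$$ (so all eigenvalues $\lambda_i(D^2u)$ are positive). Put $C'=e^{nC_0}$. Then there exist constants $c\ge -C'$ and $c_0'\in\mathbb R$ such that $$u(x)=\int_1^{|x|}t\,(ct^{-n}+C')^{\frac1n}\,dt+c_0'\qquad\text{for all }|x|>1.$$ Moreover $u$ is analytic at infinity: there is a constant $c_0\in\mathbb R$ such that $$u(x)=\frac12C'^{\frac1n}|x|^2+c_0+C'^{\frac1n}|x|^2\sum_{j=1}^{+\infty}\frac{\frac1n(\frac1n-1)\cdots(\frac1n-j+1)}{(2-nj)\,j!}\Big(\frac{c|x|^{-n}}{C'}\Big)^j$$ for $|x|>\max\{1,(|c|/C')^{1/n}\}$.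
   Context: $B_1$ is the open unit ball centered at the origin of $\mathbb R^n$; $\lambda_i(D^2u)$ are the eigenvalues of the Hessian of $u$. *)

(* Defs.v *)
From HB Require Import structures.
From mathcomp Require Import all_boot all_order all_algebra.
From mathcomp Require Import all_classical all_reals all_analysis.
Set Implicit Arguments. Unset Strict Implicit. Unset Printing Implicit Defensive.
Import Order.TTheory GRing.Theory Num.Theory.
Import numFieldNormedType.Exports.
Local Open Scope classical_set_scope.
Local Open Scope ring_scope.

(* Euclidean norm |x| (the library norm on 'rV is the sup norm, so we define it). *)
Definition enorm {R : realType} {n : nat} (x : 'rV[R]_n) : R :=
  Num.sqrt (\sum_(i < n) x ord0 i ^+ 2).

Definition evec {R : realType} {n : nat} (i : 'I_n) : 'rV[R]_n := delta_mx ord0 i.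

Definition partial {R : realType} {n : nat} (i : 'I_n) (f : 'rV[R]_n -> R)
  : 'rV[R]_n -> R := fun x => 'D_(evec i) f x.

Definition C2_on {R : realType} {n : nat} (D : set 'rV[R]_n) (f : 'rV[R]_n -> R) : Prop :=
  forall x, D x ->
    [/\ {for x, continuous f},
        (forall i, derivable f x (evec i)),
        (forall i, {for x, continuous (partial i f)}),
        (forall i j, derivable (partial j f) x (evec i)) &
        (forall i j, {for x, continuous (partial i (partial j f))})].

Definition hessian {R : realType} {n : nat} (f : 'rV[R]_n -> R) (x : 'rV[R]_n) : 'M[R]_n :=
  \matrix_(i, j) partial i (partial j f) x.

Definition eigenvalues_are {R : realType} {n : nat} (A : 'M[R]_n) (s : seq R) : Prop :=
  char_poly A = \prod_(a <- s) ('X - a%:P).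

Definition radial_ext {R : realType} {n : nat} (u : 'rV[R]_n -> R) : Prop :=
  forall x y, 1 < enorm x -> enorm x = enorm y -> u x = u y.

Definition gbinom {R : realType} (a : R) (j : nat) : R :=
  (\prod_(k < j) (a - k%:R)) / (j`!)%:R.

(* Main.v *)
(* Write v(r) for the value of u on the sphere of radius r.  At a point of a
   coordinate axis the Hessian of a radial function is diagonal, with entries
   v''(r) once and v'(r)/r with multiplicity n - 1, so the equation reads
   v'' (v'/r)^(n-1) = C', i.e. (v'^n - C' r^n)' = 0.  Hence
   v'^n = c + C' r^n; positivity of v' as r tends to 1 gives c >= -C', and
   integrating v' = r (c r^-n + C')^(1/n) gives the first formula.

   For the expansion, the binomial series B satisfies (1+y) B' = a B, so
   B(y) = (1+y)^a for |y| < 1.  With b_j the coefficients of B and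
   P(y) = sum_j b_j/(2 - n j) y^j one has 2 P - n y P' = B, which says that
   r^2 P(k r^-n) is an antiderivative of r (1 + k r^-n)^(1/n); take
   k = c/C'. *)

Require Import Defs.
From HB Require Import structures.
From mathcomp Require Import all_boot all_order all_algebra.
From mathcomp Require Import all_classical all_reals all_analysis.
From mathcomp Require Import measurable_realfun.
From mathcomp Require Import ring lra.
Import Order.TTheory GRing.Theory Num.Theory.
Import numFieldNormedType.Exports.
Local Open Scope classical_set_scope.
Local Open Scope ring_scope.

(** * Radial functions and their Hessian *)

(** Reduces a directional derivative to the derivative at 0 of a function of one real variable,
    where the one-variable chain rule applies. *)
Lemma is_derive_lineP (R : numFieldType) (V W : normedModType R) (f : V -> W) (x v : V) (d : W) :
  is_derive x v f d <-> is_derive (0 : R) 1 (fun h : R => f (h *: v + x)) d.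
Proof.
have E : (fun h : R => h^-1 *: ((f \o shift x) (h *: v) - f x)) =
  (fun h : R => h^-1 *: (((fun h : R => f (h *: v + x)) \o shift 0) (h *: 1) -
    f (0 *: v + x))).
  by apply/funext => h /=; rewrite addr0 scale0r add0r [h *: 1]mulr1.
by split => -[H1 H2]; split; rewrite /derivable /derive ?E// in H1 H2 *; rewrite -?E.
Qed.

Lemma is_derive_segment_cst (R : realType) (f : R -> R) (x y : R) :
  x <= y -> (forall z : R, x <= z <= y -> is_derive z 1 f 0) -> f x = f y.
Proof.
move=> xy df; rewrite -(subKr (f y) (f x)).
have [||_ _] := @MVT_segment R f (fun=> 0) x y xy; last first.
- by rewrite mul0r => ->; rewrite subr0.
- apply: derivable_within_continuous => z /[!in_itv]/= /df dz.
  exact: (@ex_derive _ _ _ _ _ _ _ dz).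
- by move=> z /subset_itv_oo_cc /[!in_itv]/= /df.
Qed.

Lemma is_derive_gt_cst (R : realType) (f : R -> R) (a : R) :
  (forall x : R, a < x -> is_derive x 1 f 0) ->
  forall x y, a < x -> a < y -> f x = f y.
Proof.
move=> df x y ax ay.
wlog xy : x y ax ay / x <= y by move=> H; case: (leP x y) => [|/ltW] /H ->.
by apply: is_derive_segment_cst => // z /andP[xz _]; exact/df/(lt_le_trans ax).
Qed.

Lemma is_derive1_continuous (R : realType) (f : R -> R) (x d : R) :
  is_derive x 1 f d -> {for x, continuous f}.
Proof. by move=> [df _]; apply/differentiable_continuous/derivable1_diffP. Qed.

Section Enorm.
Context {R : realType} {n : nat}.
Implicit Type x : 'rV[R]_n.

Lemma sqr_enorm x : enorm x ^+ 2 = \sum_(i < n) x ord0 i ^+ 2.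
Proof. by rewrite sqr_sqrtr// sumr_ge0// => i _; exact: sqr_ge0. Qed.

Lemma evecE (i j : 'I_n) : (evec i : 'rV[R]_n) ord0 j = (i == j)%:R.
Proof. by rewrite /evec mxE eqxx/= eq_sym. Qed.

Lemma enorm_ge0 x : 0 <= enorm x.
Proof. exact: sqrtr_ge0. Qed.

Lemma enormZ_evec (i : 'I_n) (r : R) : 0 <= r -> enorm (r *: evec i) = r.
Proof.
move=> r0; rewrite /enorm (bigD1 i)//= big1 => [|j ji].
  by rewrite mxE evecE eqxx mulr1 addr0 sqrtr_sqr ger0_norm.
by rewrite mxE evecE eq_sym (negbTE ji) mulr0 expr0n.
Qed.

Lemma sqr_enorm_line x (i : 'I_n) (h : R) :
  enorm (h *: evec i + x) ^+ 2 = enorm x ^+ 2 + (2 * x ord0 i * h + h ^+ 2).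
Proof.
have E j : (h *: evec i + x) ord0 j = h * (i == j)%:R + x ord0 j.
  by rewrite -evecE !mxE.
rewrite !sqr_enorm (bigD1 i)//= [in RHS](bigD1 i)//= E eqxx mulr1.
rewrite (eq_bigr (fun j => x ord0 j ^+ 2)) => [|j ji]; first by ring.
by rewrite E eq_sym (negbTE ji) mulr0 add0r.
Qed.

Lemma is_derive_enorm x (i : 'I_n) : 0 < enorm x ->
  is_derive x (evec i) enorm (x ord0 i / enorm x).
Proof.
move=> x0; apply/is_derive_lineP.
(* Along a coordinate line the squared norm is a quadratic polynomial with positive value at 0, so
   its square root is differentiable there. *)
pose g (h : R) := enorm x ^+ 2 + (2 * x ord0 i * h + h ^+ 2).
have -> : (fun h : R => enorm (h *: evec i + x)) = Num.sqrt \o g.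
  apply/funext => h /=.
  by rewrite /g -sqr_enorm_line sqrtr_sqr ger0_norm ?enorm_ge0.
have g0 : g 0 = enorm x ^+ 2 by rewrite /g; ring.
have dg : is_derive (0 : R) 1 g (2 * x ord0 i).
  apply: is_derive_eq; rewrite /GRing.scale/=. ring.
have gp : 0 < g 0 by rewrite g0 exprn_gt0.
have H := @is_derive1_comp _ _ _ _ _ _ (is_derive1_sqrt gp) dg.
apply: is_derive_eq; rewrite g0 sqrtr_sqr gtr0_norm//.
by field; rewrite gt_eqF.
Qed.

End Enorm.

Section Radial.
Context {R : realType} {n : nat}.
Variables (u : 'rV[R]_n -> R) (k : 'I_n).
Hypotheses (uC2 : C2_on [set x | 1 < enorm x] u) (urad : radial_ext u).
(** The profile of [u] along the [k]-th axis, and the first and second [k]-th partial derivatives of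
    [u] on that axis; these turn out to be v' and v''. *)
Let v r := u (r *: evec k).
Let p r := partial k u (r *: evec k).
Let q r := partial k (partial k u) (r *: evec k).

(** Lets identities known only for |x| > 1 be differentiated: a derivative depends only on values
    near the point. *)
Lemma near_enorm_gt1 (x : 'rV[R]_n) (i : 'I_n) : 1 < enorm x ->
  \forall h \near (0 : R), 1 < enorm (h *: evec i + x).
Proof.
move=> x1; have := is_derive_enorm x i (lt_trans ltr01 x1).
move=> /is_derive_lineP /is_derive1_continuous /= /cvgr_gt; apply.
by rewrite scale0r add0r.
Qed.

Lemma is_derive_ray (f : 'rV[R]_n -> R) (r : R) :
  derivable f (r *: evec k) (evec k) ->
  is_derive r 1 (fun s => f (s *: evec k)) (partial k f (r *: evec k)).
Proof.
move=> /derivableP /is_derive_lineP df; apply/is_derive_lineP.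
move: df; congr is_derive; apply/funext => h.
by rewrite scalerDl [h *: 1]mulr1.
Qed.

Lemma is_derive_profile (r : R) : 1 < r -> is_derive r 1 v (p r).
Proof.
move=> r1; have [_ + _ _ _] := @uC2 (r *: evec k) ltac:(by rewrite /= enormZ_evec// ltW// (lt_trans ltr01)).
by move=> /(_ k); exact: is_derive_ray.
Qed.

Lemma is_derive_profile2 (r : R) : 1 < r -> is_derive r 1 p (q r).
Proof.
move=> r1; have [_ _ _ + _] := @uC2 (r *: evec k) ltac:(by rewrite /= enormZ_evec// ltW// (lt_trans ltr01)).
by move=> /(_ k k); exact: is_derive_ray.
Qed.

Lemma radialE (x : 'rV[R]_n) : 1 < enorm x -> u x = v (enorm x).
Proof. by move=> x1; apply: urad => //; rewrite enormZ_evec// enorm_ge0. Qed.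

Lemma partial_radial (x : 'rV[R]_n) (j : 'I_n) : 1 < enorm x ->
  partial j u x = p (enorm x) * (x ord0 j / enorm x).
Proof.
move=> x1; apply: derive_val; apply/is_derive_lineP.
apply: (@near_eq_is_derive _ _ _ (v \o (fun h => enorm (h *: evec j + x)))).
  by near=> h; rewrite /= -radialE//; near: h; exact: near_enorm_gt1.
apply: is_derive1_comp.
  by rewrite scale0r add0r; exact: is_derive_profile.
by apply/(is_derive_lineP _ _ _ enorm x); apply: is_derive_enorm; exact: lt_trans x1.
Unshelve. all: by end_near. Qed.

(** Differentiates p(|x|) x_j / |x| in direction i at r e_k. To first order |x| varies only if i = k
    and x_j only if i = j, while x_j = 0 for j other than k; hence all off-diagonal entries
    vanish. *)
Lemma hessian_ray (r : R) (i j : 'I_n) : 1 < r ->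
  hessian u (r *: evec k) i j =
    if i == j then if i == k then q r else p r / r else 0.
Proof.
move=> r1; have r0 : 0 < r := lt_trans ltr01 r1.
have er : enorm (r *: evec k) = r by rewrite enormZ_evec// ltW.
have xi l : (r *: evec k) ord0 l = r * (k == l)%:R by rewrite mxE evecE.
rewrite mxE; apply: derive_val; apply/is_derive_lineP.
pose N h : R := enorm (h *: evec i + r *: evec k).
have dN : is_derive (0 : R) 1 N (k == i)%:R.
  have := is_derive_enorm (r *: evec k) i; rewrite er => /(_ r0).
  move=> /is_derive_lineP; rewrite xi.
  by have -> : r * (k == i)%:R / r = (k == i)%:R by field; rewrite gt_eqF.
have N0 : N 0 = r by rewrite /N scale0r add0r.
apply: (@near_eq_is_derive _ _ _
    (fun h => (p \o N) h * ((r * (k == j)%:R + h * (i == j)%:R) * (N h)^-1))).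
  near=> h; rewrite partial_radial; last by near: h; apply: near_enorm_gt1; rewrite er.
  by rewrite /= [X in _ = _ * (X / _)]mxE xi mxE evecE addrC.
have dp : is_derive (N 0) 1 p (q r) by rewrite N0; exact: is_derive_profile2.
have dpN := @is_derive1_comp _ _ _ _ _ _ dp dN.
have N0n : N 0 != 0 by rewrite N0 gt_eqF.
have dV := is_deriveV N0n dN.
apply: is_derive_eq; rewrite /GRing.scale/= N0.
have rn : r != 0 by rewrite gt_eqF.
rewrite (eq_sym k i) (eq_sym k j).
have [<-|ij] := eqVneq i j; first have [ik|ik] := eqVneq i k.
- rewrite ?mulr1n ?mulr0n ?mulr1.
  by field.
- by rewrite ?(negbTE ik) ?mulr0n ?mulr1n; field.
have [ik|ik] := eqVneq i k; last by rewrite ?mulr0n ?mulr1n; field.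
by have -> : (j == k) = false; [rewrite -ik eq_sym (negbTE ij)|rewrite ?mulr0n ?mulr1n; field].
Unshelve. all: by end_near. Qed.

End Radial.

(** The characteristic polynomial of a triangular matrix is the product of the X - A_ii, so diagonal
    entries are roots; its constant coefficient gives the determinant up to sign. *)
Lemma trig_mx_eigenvalues (R : realType) (n : nat) (A : 'M[R]_n) (s : seq R) :
  is_trig_mx A -> eigenvalues_are A s ->
  (forall i, A i i \in s) /\ \prod_(a <- s) a = \prod_(i < n) A i i.
Proof.
move=> trA As; split=> [i|].
  rewrite -root_prod_XsubC -As char_poly_trig// (bigD1 i)//=.
  by rewrite rootM root_XsubC eqxx.
(* Comparing degrees makes the two signs (-1)^n agree, so that they cancel. *)
have ss : size s = n.
  by have := size_char_poly A; rewrite As size_prod_XsubC => -[].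
have := char_poly_det A; rewrite As coef0_prod_XsubC ss => /mulfI -> //.
  by rewrite det_trig.
by rewrite expf_eq0 oppr_eq0 oner_eq0 andbF.
Qed.

(** Exponentiating the sum of logarithms turns the equation into det D^2u = e^(n C0), and the
    determinant is the product of the diagonal entries found on the ray. *)
Lemma radial_monge_ampere (R : realType) (n : nat) (C0 : R) (u : 'rV[R]_n -> R)
    (k : 'I_n) (r : R) :
  (1 < n)%N -> C2_on [set x | 1 < enorm x] u -> radial_ext u -> 1 < r ->
  (exists s : seq R, [/\ eigenvalues_are (hessian u (r *: evec k)) s,
                         all (fun l => 0 < l) s &
                         n%:R^-1 * \sum_(l <- s) ln l = C0]) ->
  let p := partial k u (r *: evec k) in
  0 < p /\ partial k (partial k u) (r *: evec k) * (p / r) ^+ n.-1 = expR (n%:R * C0).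
Proof.
move=> n1 uC2 urad r1 [s [As /allP s0 sC]] p.
have r0 : 0 < r := lt_trans ltr01 r1.
have trA : is_trig_mx (hessian u (r *: evec k)).
  apply/is_trig_mxP => i j ij; rewrite hessian_ray//.
  by have -> : (i == j) = false by apply/negbTE; rewrite -val_eqE ltn_eqF.
have [Ain Aprod] := trig_mx_eigenvalues _ _ _ _ trA As.
have cardk : #|[pred i : 'I_n | i != k]| = n.-1.
  by have := cardC1 k; rewrite card_ord => <-; apply: eq_card => i; rewrite !inE.
have pr0 : 0 < p / r.
  (* Since n > 1 there is an index other than [k]; its diagonal entry p/r is an eigenvalue, hence
     positive. *)
  have /card_gt0P[i] : (0 < #|[pred i : 'I_n | i != k]|)%N by rewrite cardk -ltnS prednK// ltnW.
  rewrite inE => ik; have := s0 _ (Ain i).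
  by rewrite hessian_ray// eqxx (negbTE ik).
split; first by move: pr0; rewrite pmulr_lgt0// invr_gt0.
have -> : n%:R * C0 = \sum_(l <- s) ln l.
  by rewrite -sC mulVKf// pnatr_eq0 -lt0n ltnW.
rewrite expR_sum (eq_big_seq id) => [|l /s0 l0]; last exact: lnK.
rewrite Aprod (bigD1 k)//= hessian_ray// !eqxx; congr (_ * _).
rewrite (eq_bigr (fun=> p / r)) => [|i ik]; last by rewrite hessian_ray// eqxx (negbTE ik).
by rewrite prodr_const cardk.
Qed.

(** * The radial equation *)

Lemma first_integral (R : realType) (n : nat) (C : R) (p q : R -> R) :
  (0 < n)%N ->
  (forall r : R, 1 < r -> is_derive r 1 p (q r)) ->
  (forall r : R, 1 < r -> q r * (p r / r) ^+ n.-1 = C) ->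
  exists c, forall r : R, 1 < r -> p r ^+ n = c + C * r ^+ n.
Proof.
move=> n0 dp pq; pose f : R -> R := p ^+ n - C \*: (id ^+ n).
have df (r : R) : 1 < r -> is_derive r 1 f 0.
  move=> r1; have := dp _ r1 => dpr; have r0 : r != 0 by rewrite gt_eqF// (lt_trans ltr01).
  apply: is_derive_eq; rewrite /GRing.scale/= -(pq _ r1) expr_div_n.
  by field; rewrite expf_neq0.
(* The base point 2 is an arbitrary point beyond 1. *)
exists (f 2) => r r1; rewrite -(is_derive_gt_cst _ f _ df _ _ r1) ?ltr1n//.
by rewrite /f !fctE /GRing.scale/= subrK.
Qed.

(** If c < -C, the radius (-c/C)^(1/n) exceeds 1 and makes c + C r^n vanish, against positivity. *)
Lemma first_integral_cst_ge (R : realType) (n : nat) (c C : R) :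
  (0 < n)%N -> 0 < C -> (forall r : R, 1 < r -> 0 < c + C * r ^+ n) -> - C <= c.
Proof.
move=> n0 C0 H; rewrite leNgt; apply/negP => cC.
have t1 : 1 < - c / C by rewrite ltr_pdivlMr// mul1r ltrNr.
have t0 := lt_trans ltr01 t1; have n0' : (0 : R) < n%:R by rewrite ltr0n.
have := H ((- c / C) `^ n%:R^-1).
rewrite -powR_mulrn ?powR_ge0// -powRrM mulVf ?gt_eqF// powRr1 ?ltW//.
rewrite (mulrC C) divfK ?gt_eqF// subrr ltxx => /(_ _)/negP; apply => //.
by have := @gt0_ltr_powR _ n%:R^-1 _ 1 (- c / C); rewrite powR1; apply; rewrite ?invr_gt0// nnegrE// ltW.
Qed.

Lemma powR_expVn (R : realType) (n : nat) (x : R) :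
  (0 < n)%N -> 0 <= x -> (x ^+ n) `^ n%:R^-1 = x.
Proof.
by move=> n0 x0; rewrite -powR_mulrn// -powRrM divff ?powRr1// pnatr_eq0 -lt0n.
Qed.

Lemma profile_derivE (R : realType) (n : nat) (c C p r : R) :
  (0 < n)%N -> 0 < r -> 0 <= p -> p ^+ n = c + C * r ^+ n ->
  p = r * (c * r ^- n + C) `^ n%:R^-1.
Proof.
move=> n0 r0 p0 E.
have -> : c * r ^- n + C = (p / r) ^+ n.
  by rewrite expr_div_n E; field; rewrite expf_neq0// gt_eqF.
by rewrite powR_expVn ?divr_ge0// ?ltW//; field; rewrite gt_eqF.
Qed.

(** The interval includes t = 1, where [u] gives no control, so integrability comes from
    boundedness: for t >= 1 one has 0 <= t^-n <= 1, and c >= -C keeps the base of the root between 0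
    and |c| + C. *)
Lemma integrable_profile_deriv (R : realType) (n : nat) (c C r : R) :
  0 < C -> - C <= c ->
  (@lebesgue_measure R).-integrable `[1, r]
    (EFin \o (fun t => t * (c * t ^- n + C) `^ n%:R^-1)).
Proof.
move=> C0 cC.
have t1P (t : R) : t \in `[1, r]%classic -> 1 <= t <= r by rewrite inE/= in_itv.
(* The real power agrees with t^-n for t >= 0 and is measurable on the whole line. *)
pose h (t : R) : R := t * (c * t `^ (- n%:R) + C) `^ n%:R^-1.
refine (@eq_integrable _ _ _ (@lebesgue_measure R) _ (measurable_itv _) (EFin \o h) _ _ _).

- by move=> t /t1P/andP[t1 _]; rewrite /h /= powR_invn// (le_trans ler01).
apply: measurable_bounded_integrable.
- exact: measurable_itv.
- rewrite /= lebesgue_measure_itv/=; case: ifP => _; last exact: ltry.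
  by rewrite -EFinB ltry.
- apply: measurable_funTS; apply: measurable_funM => //.
  apply: (@measurableT_comp _ _ _ _ _ _ (@powR R ^~ n%:R^-1)).
    exact: measurable_powR.
  apply: measurable_funD => //; apply: measurable_funM => //.
apply: filterS (nbhs_pinfty_ge (num_real (r * (`|c| + C) `^ n%:R^-1))) => M rM t /=.
rewrite in_itv/= => /andP[t1 tr]; apply: le_trans rM.
have t0 : 0 < t by rewrite (lt_le_trans ltr01).
have ti : 0 <= t ^- n <= 1.
  by apply/andP; split; [rewrite invr_ge0 exprn_ge0// ltW|rewrite invf_le1 ?exprn_gt0// exprn_ege1].
have b0 : 0 <= c * t ^- n + C by case/andP: ti => ti0 ti1; nra.
have bC : c * t ^- n + C <= `|c| + C.
  case/andP: ti => ti0 ti1; have := ler_norm c; have := normr_ge0 c; nra.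
rewrite /h powR_invn ?(ltW t0)// ger0_norm; last by rewrite mulr_ge0 ?powR_ge0// ltW.
apply: ler_pM => //; rewrite ?powR_ge0// ?(ltW t0)//.
by apply: (@ge0_ler_powR R n%:R^-1 _ _ _ _ _ bC); rewrite ?invr_ge0// nnegrE// addr_ge0// ltW.
Qed.

(** The fundamental theorem of calculus is applied only on [s, r] with s > 1, where [v] is
    differentiable. Hence v - G is constant beyond 1, although G integrates from 1. *)
Lemma integral_representation (R : realType) (n : nat) (c C : R) (v p : R -> R) :
  let g := fun t => t * (c * t ^- n + C) `^ n%:R^-1 in
  0 < C -> - C <= c ->
  (forall r : R, 1 < r -> is_derive r 1 v (p r)) ->
  (forall r : R, 1 < r -> {for r, continuous p}) ->
  (forall r : R, 1 < r -> p r = g r) ->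
  exists c0, forall r : R, 1 < r -> v r = Rintegral lebesgue_measure `[1, r] g + c0.
Proof.
move=> g C0 cC dv pc pg; pose G r := Rintegral lebesgue_measure `[1, r] g.
have ig r : lebesgue_measure.-integrable `[1, r] (EFin \o g).
  exact: integrable_profile_deriv.
have step s r : 1 < s -> s < r -> G r - G s = v r - v s.
  move=> s1 sr.
  have igo : lebesgue_measure.-integrable `]s, r] (EFin \o g).
    move: (ig r); apply: integrableS => //.
    by apply: subset_itvr; rewrite bnd_simp ltW.
  rewrite /G Rintegral_itvB//; [|by rewrite bnd_simp ltW|by rewrite bnd_simp ltW].
  rewrite Rintegral_itv_obnd_cbnd//.
  have gt1 t : t \in `[s, r] -> 1 < t.
    by rewrite in_itv/= => /andP[st _]; exact: lt_le_trans s1 st.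
  have -> : Rintegral lebesgue_measure `[s, r] g = Rintegral lebesgue_measure `[s, r] p.
    by apply: eq_Rintegral => t /[!inE] ts; exact/esym/pg/gt1.
  rewrite /Rintegral (@continuous_FTC2 R p v s r sr)//.
  - apply: continuous_in_subspaceT => t /[!inE] /= ts.
    exact/pc/gt1.
  - have vc t : 1 < t -> {for t, continuous v} by move=> /dv/is_derive1_continuous.
    split.
    + move=> t /subset_itv_oo_cc/gt1/dv dvt; exact: ex_derive.
    + by apply: cvg_at_right_filter; exact: vc.
    + by apply: cvg_at_left_filter; exact/vc/(lt_trans s1).
  - move=> t /subset_itv_oo_cc/gt1/dv dvt; rewrite derive1E; exact: derive_val.
exists (v 2 - G 2) => r r1; rewrite -/(G r).
have l2 : (1 : R) < 2 by rewrite ltr1n.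
have [r2|r2|->] := ltgtP r 2; last by rewrite addrC subrK.
  by have := step _ _ r1 r2; lra.
by have := step _ _ l2 r2; lra.
Qed.

(** * The binomial series *)

Lemma gbinom0 (R : realType) (a : R) : gbinom a 0 = 1.
Proof. by rewrite /gbinom big_ord0 fact0 divr1. Qed.

Lemma gbinomS (R : realType) (a : R) (j : nat) :
  j.+1%:R * gbinom a j.+1 = (a - j%:R) * gbinom a j.
Proof.
rewrite /gbinom big_ord_recr/= factS natrM.
by field; rewrite nat1r !pnatr_eq0/= -lt0n fact_gt0.
Qed.

(** Induction on the recurrence: consecutive coefficients have ratio |a - j| / (j + 1), at most 1
    when a lies in [0, 1]. *)
Lemma norm_gbinom_le1 (R : realType) (a : R) (j : nat) :
  0 <= a <= 1 -> `|gbinom a j| <= 1.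
Proof.
move=> a01; elim: j => [|j IH]; first by rewrite gbinom0 normr1.
have j0 : (0 : R) < j.+1%:R by rewrite ltr0n.
have E : j.+1%:R * `|gbinom a j.+1| = `|a - j%:R| * `|gbinom a j|.
  by rewrite -[X in X * _ = _](ger0_norm (ltW j0)) -!normrM gbinomS.
rewrite -(ler_pM2l j0) mulr1 E.
apply: (le_trans (ler_piMr (normr_ge0 _) IH)).
have j1 := ler0n R j; case/andP: a01 => a0 a1.
by rewrite ler_norml -natr1; apply/andP; split; lra.
Qed.

Lemma is_cvg_pseries_bounded (R : realType) (f : R^nat) (x M : R) :
  (forall j, `|f j| <= M) -> `|x| < 1 -> cvgn (pseries f x).
Proof.
move=> fM x1; apply: normed_cvg.
have M0 : 0 <= M by exact: le_trans (fM 0%N).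
apply: (@series_le_cvg _ _ (geometric M `|x|)) => [j|j|j|] //=.
- by rewrite mulr_ge0// exprn_ge0.
- by rewrite normrM normrX ler_wpM2r// exprn_ge0.
- by apply: is_cvg_geometric_series; rewrite normr_id.
Qed.

Lemma natr_exp_le (R : realFieldType) (s : R) (j : nat) :
  0 <= s -> s < 1 -> j.+1%:R * s ^+ j <= (1 - s)^-1.
Proof.
move=> s0 s1; have s2 : 0 < 1 - s by rewrite subr_gt0.
have sV : (1 - s)^-1 = s * (1 - s)^-1 + 1 by field; rewrite gt_eqF.
elim: j => [|j IH].
  by rewrite mul1r sV lerDr mulr_ge0// invr_ge0 ltW.
have -> : j.+2%:R * s ^+ j.+1 = s * (j.+1%:R * s ^+ j) + s ^+ j.+1.
  by rewrite -natr1 exprS; ring.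
by rewrite sV lerD// ?ler_wpM2l// exprn_ile1// ltW.
Qed.

(** Convergence at K bounds the terms f_j K^j by some M; the derived series at x is then dominated
    by a geometric series. *)
Lemma is_cvg_pseries_diffs (R : realType) (f : R^nat) (K x : R) :
  cvgn (pseries f K) -> `|x| < `|K| -> cvgn (pseries (pseries_diffs f) x).
Proof.
move=> /cvg_series_bounded fK xK.
have [M fM] : exists M, forall j, `|f j * K ^+ j| <= M.
  have [N [_ /(_ (N + 1))]] := fK; rewrite ltrDl ltr01 => /(_ isT) H.
  by exists (N + 1) => j; exact: H.
have K0 : 0 < `|K| by exact: le_lt_trans xK.
pose s := `|x| / `|K|; have s0 : 0 <= s by rewrite divr_ge0.
have s1 : s < 1 by rewrite ltr_pdivrMr// mul1r.
(* The ratio s = |x|/|K| is split as (s/y) y: powers of s/y absorb the factor j + 1, powers of y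
   give the geometric series. *)
have [y [sy y0 y1]] : exists y : R, [/\ s < y, 0 < y & y < 1].
  by exists ((s + 1) / 2); split; lra.
have z0 : 0 <= s / y by rewrite divr_ge0// ltW.
have z1 : s / y < 1 by rewrite ltr_pdivrMr// mul1r.
have M0 : 0 <= M by exact: le_trans (fM 0%N).
apply: normed_cvg.
apply: (@series_le_cvg _ _ (geometric (M / `|K| * (1 - s / y)^-1) y)) => [j|j|j|] //=.
- by rewrite !mulr_ge0// ?invr_ge0// ?exprn_ge0 ?subr_ge0// ltW.
- have -> : `|pseries_diffs f j * x ^+ j| =
      `|f j.+1 * K ^+ j.+1| / `|K| * (j.+1%:R * (s / y) ^+ j) * y ^+ j.
    rewrite /pseries_diffs !normrM !normrX (ger0_norm (ler0n _ _)).
    rewrite /s !expr_div_n exprS; field.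
    by rewrite !expf_neq0 ?gt_eqF//.
  rewrite ler_wpM2r ?exprn_ge0 ?(ltW y0)//; apply: ler_pM.
  + by rewrite divr_ge0.
  + by rewrite mulr_ge0// exprn_ge0.
  + by rewrite ler_wpM2r// invr_ge0.
  + exact: natr_exp_le.
- by apply: is_cvg_geometric_series; rewrite ger0_norm// ltW.
Qed.

Lemma is_derive_pseries (R : realType) (f : R^nat) (x M : R) :
  (forall j, `|f j| <= M) -> `|x| < 1 ->
  is_derive x 1 (fun x => limn (pseries f x)) (limn (pseries (pseries_diffs f) x)).
Proof.
move=> fM x1; have x0 := normr_ge0 x.
(* Termwise differentiation requires convergence of the series and of its first two derived series
   at a radius beyond |x|. Each derivation costs some radius, hence the chain |x| = K 0 < K 1 < K 2
   < K 3 < 1. *)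
pose K (i : nat) : R := `|x| + (1 - `|x|) * i%:R / 4.
have nK i : (i <= 3)%N -> `|K i| = K i /\ K i < 1.
  move=> i3; have iR := ler0n R i.
  have i3R : i%:R <= 3 :> R by rewrite ler_nat.
  split; last by rewrite /K; nra.
  by rewrite ger0_norm// /K; nra.
have lK i j : (i < j)%N -> (j <= 3)%N -> `|K i| < `|K j|.
  move=> ij j3; rewrite (nK _ j3).1 (nK i (leq_trans (ltnW ij) j3)).1.
  have : i%:R < j%:R :> R by rewrite ltr_nat.
  by rewrite /K; nra.
have c3 : cvgn (pseries f (K 3%N)).
  by apply: (is_cvg_pseries_bounded _ _ _ _ fM); case: (nK 3%N (leqnn _)) => -> ->.
have c2 : cvgn (pseries (pseries_diffs f) (K 2%N)).
  exact: is_cvg_pseries_diffs c3 (lK _ _ _ _).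
apply: (pseries_snd_diffs (K := K 1%N)).
- exact: is_cvg_pseries_inside c3 (lK _ _ _ _).
- exact: is_cvg_pseries_inside c2 (lK _ _ _ _).
- exact: is_cvg_pseries_diffs c2 (lK _ _ _ _).
- by have := lK 0%N 1%N isT isT; rewrite {1}/K mulr0 mul0r addr0 normr_id.
Qed.

Lemma is_derive_ball_cst (R : realType) (f : R -> R) (a : R) :
  (forall x : R, `|x| < a -> is_derive x 1 f 0) -> forall x : R, `|x| < a -> f x = f 0.
Proof.
move=> df x xa; have [x0|/ltW x0] := leP x 0.
  apply: is_derive_segment_cst => // z /andP[xz z0]; apply: df.
  by rewrite (le_lt_trans _ xa)// !ler0_norm// lerN2.
apply/esym/is_derive_segment_cst => // z /andP[z0 zx]; apply: df.
by rewrite (le_lt_trans _ xa)// !ger0_norm.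
Qed.

Lemma cvg_pseries_gbinom (R : realType) (a y : R) :
  0 <= a <= 1 -> `|y| < 1 -> cvgn (pseries (gbinom a) y).
Proof. by move=> a01; apply: is_cvg_pseries_bounded => j; exact: norm_gbinom_le1. Qed.

Lemma gbinom_diffs_ode (R : realType) (a y : R) : 0 <= a <= 1 -> `|y| < 1 ->
  (1 + y) * limn (pseries (pseries_diffs (gbinom a)) y) =
    a * limn (pseries (gbinom a) y).
Proof.
move=> a01 y1; set b := gbinom a.
have cb : cvgn (pseries b y) by exact: cvg_pseries_gbinom.
have cd : cvgn (pseries (pseries_diffs b) y).
  have ny := normr_ge0 y; pose K : R := (1 + `|y|) / 2.
  have K1 : `|K| = K by rewrite ger0_norm// /K; lra.
  apply: (is_cvg_pseries_diffs _ _ K).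
    by apply: cvg_pseries_gbinom; rewrite // K1 /K; lra.
  by rewrite K1 /K; lra.
have /cvg_lim ce := pseries_diffs_equiv cd.
have cs := is_cvg_pseries_diffs_equiv cd.
(* Coefficientwise this is (j + 1) b_(j+1) + j b_j = a b_j. At j = 0 the truncated exponent [j.-1]
   is harmless because of the factor j. *)
have E : a *: (fun j => b j * y ^+ j) =
   (fun j => pseries_diffs b j * y ^+ j) + y *: (fun j => j%:R * b j * y ^+ j.-1).
  apply/funext => -[|j]; rewrite !fctE /GRing.scale/= /pseries_diffs /b.
    by rewrite gbinomS; ring.
  by rewrite gbinomS exprS; ring.
have cys : cvgn (series (y *: (fun j => j%:R * b j * y ^+ j.-1))).
  by apply: is_cvg_seriesZ; exact: cs.
have := lim_seriesZ a cb; rewrite /= E lim_seriesD// (lim_seriesZ _ cs) ce//.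
by rewrite /GRing.scale/= => <-; rewrite mulrDl mul1r.
Qed.

(** By the differential equation for B, the product B(y) (1 + y)^(-a) has zero derivative on |y| <
    1, and it equals 1 at 0. *)
Lemma binomial_series (R : realType) (a y : R) : 0 <= a <= 1 -> `|y| < 1 ->
  limn (pseries (gbinom a) y) = (1 + y) `^ a.
Proof.
move=> a01; pose B (y : R) : R := limn (pseries (gbinom a) y).
have B0 : B 0 = 1.
  (* At y = 0 every nonempty partial sum equals its first term 1; the empty one, m = 0, has to be
     excluded. *)
  apply/lim_near_cst => //; near=> m; rewrite /pseries /series/=.
  rewrite -[m]prednK; last by near: m; exact: nbhs_infty_gt.
  rewrite big_nat_recl//= gbinom0 mulr1 big1 ?addr0// => i _.
  by rewrite expr0n mulr0.
have pos (z : R) : `|z| < 1 -> 0 < 1 + z by rewrite ltr_norml => /andP[]; lra.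
pose f (z : R) := B z * (1 + z) `^ (- a).
have df (z : R) : `|z| < 1 -> is_derive z 1 f 0.
  move=> z1; have z0 := pos _ z1.
  have dB : is_derive z 1 B (limn (pseries (pseries_diffs (gbinom a)) z)).
    by apply: (is_derive_pseries _ _ _ 1) => // j; exact: norm_gbinom_le1.
  have dp : is_derive z 1 ((@powR R ^~ (- a)) \o (fun z : R => 1 + z)) (- a * (1 + z) `^ (- a - 1) * 1).
    apply: is_derive1_comp; first exact: is_derive1_powR.
    have := is_deriveD (is_derive_cst (1 : R) z 1) (is_derive_id z (1 : R)).
    by rewrite add0r.
  have := is_deriveM dB dp => dfz; apply: is_derive_eq.
  have -> : (1 + z) `^ (- a - 1) = (1 + z) `^ (- a) / (1 + z).
    by rewrite powRB ?powRr1 ?(ltW z0)//; apply/implyP => _; rewrite gt_eqF.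
  rewrite /GRing.scale/=.
  have := gbinom_diffs_ode _ _ _ a01 z1; rewrite -/(B z).
  set D := limn _ => ode; have z0' : 1 + z != 0 by rewrite gt_eqF.
  have -> : D = a * B z / (1 + z) by rewrite -ode; field.
  by field.
move=> y1; have y0 := pos _ y1.
have := is_derive_ball_cst _ _ _ df _ y1.
rewrite /f B0 addr0 powR1 mulr1 powRN => /divr1_eq.
by [].
Unshelve. all: by end_near. Qed.

(** * The expansion at infinity *)

Section AntiderivativeSeries.
Context {R : realType} (n : nat) (a : R).
Hypotheses (n3 : (3 <= n)%N) (a01 : 0 <= a <= 1).
Let d (j : nat) : R := gbinom a j / (2 - n%:R * j%:R).

(** The denominator is 2 at j = 0 and at most 2 - n <= -1 afterwards. This is where n >= 3 matters:
    for n = 2 it would vanish at j = 1. *)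
Lemma normr_antideriv_denom (j : nat) : 1 <= `|2 - n%:R * j%:R| :> R.
Proof.
have nR : (3 : R) <= n%:R by rewrite ler_nat.
case: j => [|j]; first by rewrite mulr0 subr0 ger0_norm// ler1n.
have jR := ler0n R j; rewrite ler_normr; apply/orP; right.
by rewrite -natr1; nra.
Qed.

Lemma antideriv_denom_neq0 (j : nat) : 2 - n%:R * j%:R != 0 :> R.
Proof. by rewrite -normr_gt0 (lt_le_trans ltr01)// normr_antideriv_denom. Qed.

Lemma norm_antideriv_coef_le1 (j : nat) : `|d j| <= 1.
Proof.
have d1 := normr_antideriv_denom j.
rewrite /d normf_div ler_pdivrMr ?(lt_le_trans ltr01)// mul1r.
exact/(le_trans _ d1)/norm_gbinom_le1.
Qed.

Let P (y : R) : R := limn (pseries d y).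

Lemma cvg_antideriv (y : R) : `|y| < 1 -> cvgn (pseries d y).
Proof. by apply: is_cvg_pseries_bounded => j; exact: norm_antideriv_coef_le1. Qed.

Lemma antideriv_ode (y : R) : `|y| < 1 ->
  2 * P y - n%:R * y * limn (pseries (pseries_diffs d) y) = (1 + y) `^ a.
Proof.
move=> y1; rewrite -binomial_series//.
have cd := cvg_antideriv _ y1.
have cdd : cvgn (pseries (pseries_diffs d) y).
  have ny := normr_ge0 y; pose K : R := (1 + `|y|) / 2.
  have K1 : `|K| = K by rewrite ger0_norm// /K; lra.
  apply: (is_cvg_pseries_diffs _ _ K).
    by apply: cvg_antideriv; rewrite // K1 /K; lra.
  by rewrite K1 /K; lra.
have /cvg_lim ce := pseries_diffs_equiv cdd.
have cs := is_cvg_pseries_diffs_equiv cdd.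
(* Coefficientwise this is b_j = (2 - n j) d_j, the term j d_j y^j coming from y P'. *)
have E : (fun j => gbinom a j * y ^+ j) =
   2 *: (fun j => d j * y ^+ j) - (n%:R * y) *: (fun j => j%:R * d j * y ^+ j.-1).
  apply/funext => j; rewrite !fctE /GRing.scale/=.
  have -> : gbinom a j = (2 - n%:R * j%:R) * d j.
    by rewrite mulrC divfK// antideriv_denom_neq0.
  by case: j => [|j]; rewrite ?exprS/=; ring.
rewrite [in RHS]/pseries E lim_seriesB; last 2 first.
  by apply: is_cvg_seriesZ; exact: cd.
  by apply: is_cvg_seriesZ; exact: cs.
by rewrite (lim_seriesZ _ cd) (lim_seriesZ _ cs) ce.
Qed.

(** With y = k r^-n one has y' = -n y / r, so the derivative of r^2 P(y) is r (2 P - n y P'), which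
    the preceding equation evaluates. *)
Lemma is_derive_antideriv (k r : R) : 0 < r -> `|k * r ^- n| < 1 ->
  is_derive r 1 (fun r => r ^+ 2 * P (k * r ^- n)) (r * (1 + k * r ^- n) `^ a).
Proof.
move=> r0 y1; have rn0 : r != 0 by rewrite gt_eqF.
pose y (s : R) : R := k * s ^- n.
have dy : is_derive r 1 y (k * (- n%:R * r ^- n / r)).
  have rX : (id ^+ n : R -> R) r != 0 by rewrite fctE expf_neq0.
  have := is_deriveZ k (is_deriveV rX (is_deriveX n (is_derive_id r (1 : R)))).
  have -> : k \*: (fun s : R => ((id ^+ n : R -> R) s)^-1) = y.
    by apply/funext => s; rewrite !fctE.
  move=> dk; apply: (@is_derive_eq _ _ _ _ _ _ _ _ dk).
  rewrite /GRing.scale/= !fctE.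
  have -> : r ^+ n = r * r ^+ n.-1 by rewrite -exprS prednK// (leq_trans _ n3).
  by field; rewrite rn0 expf_neq0.
have dP : is_derive (y r) 1 P (limn (pseries (pseries_diffs d) (y r))).
  by apply: (is_derive_pseries _ _ _ 1) => // j; exact: norm_antideriv_coef_le1.
have := is_deriveM (is_deriveX 2 (is_derive_id r (1 : R))) (is_derive1_comp dP dy).
move=> dF; apply: (@is_derive_eq _ _ _ _ _ _ _ _ dF).
rewrite -antideriv_ode// /GRing.scale/= !fctE -/(y r).
by rewrite /y; field; rewrite rn0 expf_neq0.
Qed.

(** The expansion sums from j = 1 whereas P starts at j = 0; the difference is the coefficient d_0 =
    1/2. *)
Lemma cvg_antideriv_tail (y : R) : `|y| < 1 ->
  series (fun j => gbinom a j.+1 / (2 - n%:R * j.+1%:R) * y ^+ j.+1) @ \oo -->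
    P y - 2^-1.
Proof.
move=> y1; have /cvg_ex[l /= dl] := cvg_antideriv _ y1.
have -> : P y = l by apply/cvg_lim.
have -> : series (fun j => gbinom a j.+1 / (2 - n%:R * j.+1%:R) * y ^+ j.+1) =
    (fun m => pseries d y m.+1 - 2^-1).
  apply/funext => m; rewrite /pseries /series/= big_nat_recl//.
  by rewrite /d gbinom0 mulr0 subr0 expr0 mulr1 mul1r addrC addKr.
apply: cvgB; last exact: cvg_cst.
by move: dl; rewrite -(cvg_shiftS (pseries d y)).
Qed.

End AntiderivativeSeries.

(** * Both formulas for u, assembled from its profile along one axis *)

Theorem theorem2p1 (R : realType) (n : nat) (C0 : R) (u : 'rV[R]_n -> R) :
  (3 <= n)%N ->
  C2_on [set x | 1 < enorm x] u ->
  radial_ext u ->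
  (forall x, 1 < enorm x ->
     exists s : seq R, [/\ eigenvalues_are (hessian u x) s,
                           all (fun l => 0 < l) s &
                           n%:R^-1 * \sum_(l <- s) ln l = C0]) ->
  let C' := expR (n%:R * C0) in
  exists c : R, -C' <= c /\
    (exists c0' : R, forall x, 1 < enorm x ->
       u x = Rintegral lebesgue_measure `[1, enorm x]%classic
                 (fun t => t * (c * t ^- n + C') `^ n%:R^-1) + c0') /\
    (exists c0 : R, forall x, Num.max 1 ((`|c| / C') `^ n%:R^-1) < enorm x ->
       exists S : R,
         series (fun j => gbinom n%:R^-1 j.+1 / (2 - n%:R * j.+1%:R)
                          * (c * enorm x ^- n / C') ^+ j.+1) @ \oo --> S /\
         u x = 2^-1 * C' `^ n%:R^-1 * enorm x ^+ 2 + c0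
               + C' `^ n%:R^-1 * enorm x ^+ 2 * S).
Proof.
move=> n3 uC2 urad ueq C'.
have n0 : (0 < n)%N by exact: leq_trans n3.
have nR : (0 : R) < n%:R by rewrite ltr0n.
(* By radial symmetry any axis would serve; n > 0 provides the first one. *)
pose k := Ordinal n0.
pose v r := u (r *: evec k); pose p r := partial k u (r *: evec k).
pose q r := partial k (partial k u) (r *: evec k).
have dv (r : R) : 1 < r -> is_derive r 1 v (p r) by exact: is_derive_profile.
have dp (r : R) : 1 < r -> is_derive r 1 p (q r) by exact: is_derive_profile2.
have uv x : 1 < enorm x -> u x = v (enorm x) by exact: radialE.
have ma (r : R) : 1 < r -> 0 < p r /\ q r * (p r / r) ^+ n.-1 = C'.
  move=> r1; apply: radial_monge_ampere => //; first exact: leq_trans n3.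
  by apply: ueq; rewrite enormZ_evec// (le_trans ler01)// ltW.
have C'0 : 0 < C' by exact: expR_gt0.
have [c pc] := first_integral _ _ _ _ _ n0 dp (fun r r1 => (ma r r1).2).
have cC : - C' <= c.
  apply: (first_integral_cst_ge _ n) => // r r1.
  by rewrite -pc// exprn_gt0// (ma r r1).1.
pose g t : R := t * (c * t ^- n + C') `^ n%:R^-1.
have pg (r : R) : 1 < r -> p r = g r.
  move=> r1; apply: profile_derivE => //; last exact: pc.
    exact: lt_trans r1.
  by rewrite ltW// (ma r r1).1.
have pcont (r : R) : 1 < r -> {for r, continuous p}.
  by move=> /dp/is_derive1_continuous.
exists c; split=> //; split.
  have [c0 vE] := integral_representation _ n _ _ _ _ C'0 cC dv pcont pg.
  by exists c0 => x x1; rewrite uv// vE.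
set r0 := Num.max _ _.
have a01 : 0 <= (n%:R^-1 : R) <= 1.
  by rewrite invr_ge0 ler0n/= invf_le1// ler1n.
(* Raising (|c|/C')^(1/n) < r to the n-th power places the argument inside the unit disc of
   convergence. *)
have yr (r : R) : r0 < r -> `|c / C' * r ^- n| < 1.
  rewrite gt_max => /andP[r1 cr]; have r_gt0 : 0 < r := lt_trans ltr01 r1.
  rewrite normrM normf_div (gtr0_norm C'0) normfV normrX (gtr0_norm r_gt0).
  rewrite ltr_pdivrMr ?exprn_gt0// mul1r.
  have b0 : 0 <= `|c| / C' by rewrite divr_ge0// ltW.
  have := @gt0_ltr_powR _ n%:R nR ((`|c| / C') `^ n%:R^-1) r.
  rewrite !nnegrE powR_ge0 (ltW r_gt0) => /(_ isT isT cr).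
  by rewrite -powRrM mulVf ?gt_eqF// powRr1// powR_mulrn// ltW.
pose P (y : R) : R := limn (pseries (fun j => gbinom n%:R^-1 j / (2 - n%:R * j%:R)) y).
pose F (r : R) : R := r ^+ 2 * P (c / C' * r ^- n).
(* Factoring C' out of the root gives g(r) = C'^(1/n) r (1 + (c/C') r^-n)^(1/n), so v and C'^(1/n) F
   have the same derivative beyond [r0]. The constant value of G is the c_0 sought. *)
pose G := v - C' `^ n%:R^-1 \*: F.
have dG (r : R) : r0 < r -> is_derive r 1 G 0.
  move=> rr0; have y1 := yr r rr0.
  have r1 : 1 < r by move: rr0; rewrite gt_max => /andP[].
  have r_gt0 : 0 < r := lt_trans ltr01 r1.
  have dF := is_derive_antideriv _ _ n3 a01 _ _ r_gt0 y1.
  apply: (@is_derive_eq _ _ _ _ _ _ _ _ (is_deriveB (dv _ r1) (is_deriveZ (C' `^ n%:R^-1) dF))).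
  have y0 : 0 <= 1 + c / C' * r ^- n.
    by move: y1; rewrite ltr_norml => /andP[]; lra.
  rewrite pg// /g /GRing.scale/= mulrCA -powRM// ?ltW//.
  suff -> : C' * (1 + c / C' * r ^- n) = c * r ^- n + C' by rewrite subrr.
  by field; rewrite !gt_eqF// exprn_gt0.
exists (G (r0 + 1)) => x xr0.
have x1 : 1 < enorm x by move: xr0; rewrite gt_max => /andP[].
have yE : c * enorm x ^- n / C' = c / C' * enorm x ^- n by rewrite mulrAC.
(* The 1/2 removed from P reappears as the leading term (1/2) C'^(1/n) |x|^2. *)
exists (P (c / C' * enorm x ^- n) - 2^-1); split.
  rewrite yE; apply: cvg_antideriv_tail => //; exact: yr.
have -> : G (r0 + 1) = G (enorm x).
  by apply: (is_derive_gt_cst _ _ r0) => //; rewrite ltrDl.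
have -> : G (enorm x) = v (enorm x) - C' `^ n%:R^-1 * F (enorm x) by [].
by rewrite uv// /F; field.
Qed.
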